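(* Let $(\mathfrak g,\mathcal F_\bullet\mathfrak g,R)$ be a filtered Rota–Baxter Lie algebra over a field $\mathbf k$ of characteristic zero and let $\mathfrak R:\widehat{\mathfrak g}\to\widehat{\mathfrak g}$ be the Rota–Baxter operator on the group $(\widehat{\mathfrak g},* )$ given by $\mathfrak R(x)=\log(\widehat{\mathcal R}(\exp(x)))$. Then $\mathfrak R=\widehat R\circ\Omega$, where $\Omega$ is the post-Lie Magnus expansion and $\widehat R$ is the completion of $R$ (see context).
   Context: A filtered Lie algebra $(\mathfrak g,\mathcal F_\bullet\mathfrak g)$: a Lie algebra with subspaces $\mathfrak g=\mathcal F_1\mathfrak g\supset\mathcal F_2\mathfrak g\supset\cdots$, $[\mathcal F_n\mathfrak g,\mathcal F_m\mathfrak g]\subset\mathcal F_{n+m}\mathfrak g$. A Rota–Baxter operator of weight 1: linear $R$ with $[R(x),R(y)]=R([R(x),y]+[x,R(y)]+[x,y])$; filtered Rota–Baxter Lie algebra: additionally $R(\mathcal F_n\mathfrak g)\subset\mathcal F_n\mathfrak g$ for all $n$. Filtered universal enveloping algebra: $\mathcal F_0U(\mathfrak g)=U(\mathfrak g)$, and for $n\ge1$, $\mathcal F_nU(\mathfrak g)$ is spanned by products $x_1\cdots x_k$ ($k\ge1$, $x_i\in\mathcal F_{n_i}\mathfrak g$, $\sum n_i\ge n$). $\mathcal R:U(\mathfrak g)\to U(\mathfrak g)$ is the well-defined linear map with $\mathcal R(1)=1$, $\mathcal R(x)=R(x)$, $\mathcal R(xh)=R(x)\mathcal R(h)-\mathcal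 R([R(x),h])$ ($x\in\mathfrak g$, $h\in U(\mathfrak g)$); it preserves the filtration and so induces $\widehat{\mathcal R}$ on $\widehat U(\mathfrak g)=\varprojlim U(\mathfrak g)/\mathcal F_nU(\mathfrak g)$. Define $a\star b=a_{(1)}\mathcal R(a_{(2)})\,b\,S(\mathcal R(a_{(3)}))$ on $U(\mathfrak g)$ (Sweedler notation, $S$ the antipode); it is compatible with the filtration and extends to $\widehat U(\mathfrak g)$. $\widehat{\mathfrak g}=\varprojlim\mathfrak g/\mathcal F_{n+1}\mathfrak g$ is regarded as a subspace of $\mathcal F_1\widehat U(\mathfrak g)$ (the kernel of $\widehat U(\mathfrak g)\to U(\mathfrak g)/\mathcal F_1U(\mathfrak g)$). $\mathbb G$ is the group of nonzero group-like elements ($\widehat\Delta(g)=g\hat\otimes g$) of the complete Hopf algebra $\widehat U(\mathfrak g)$. The maps $\exp(x)=\sum_{n\ge0}x^n/n!$ and $\exp_\star(x)=\sum_{n\ge0}x^{\star n}/n!$ (with $x^{\star n}=x\star\cdots\star x$, $n$ factors) are bijections $\widehat{\mathfrak g}\to\mathbb G$; their inverses are $\log$ and $\log_\star$. The group structure on $\widehat{\mathfrak g}$ is $x*y=\log(\exp(x)\exp(y))$, and $\widehat{\mathcal R}(\mathbb G)\subset\mathbb G$. The post-Lie Magnus expansion is $\Omega:\widehat{\mathfrak g}\to\widehat{\mathfrak g}$, $\Omega(x)=\log_\star(\exp(x))$. The completion $\widehat R:\widehat{\mathfrak g}\to\widehat{\mathfrak g}$ acts componentwise by the maps $\mathfrak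 g/\mathcal F_{n+1}\mathfrak g\to\mathfrak g/\mathcal F_{n+1}\mathfrak g$ induced by $R$. *)

(* Defs.v *)
From HB Require Import structures.
From mathcomp Require Import all_boot all_order all_algebra.
Set Implicit Arguments. Unset Strict Implicit. Unset Printing Implicit Defensive.
Import Order.TTheory GRing.Theory Num.Theory.
Local Open Scope ring_scope.

Section Defs.
Variable K : fieldType.
Variable g : lmodType K.

Definition is_lie_bracket (br : g -> g -> g) : Prop :=
  [/\ forall a x y z, br (a *: x + y) z = a *: br x z + br y z,
      forall a x y z, br z (a *: x + y) = a *: br z x + br z y,
      forall x, br x x = 0 &
      forall x y z, br x (br y z) + br y (br z x) + br z (br x y) = 0].

Definition is_subspace (P : g -> Prop) : Prop :=
  P 0 /\ forall a x y, P x -> P y -> P (a *: x + y).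

(* F n is F_n g, only used for n >= 1:  g = F_1 g ⊃ F_2 g ⊃ ... *)
Definition is_lie_filtration (br : g -> g -> g) (F : nat -> g -> Prop) : Prop :=
  [/\ forall x, F 1%N x,
      forall n, (1 <= n)%N -> is_subspace (F n),
      forall n x, (1 <= n)%N -> F n.+1 x -> F n x &
      forall n m x y, (1 <= n)%N -> (1 <= m)%N -> F n x -> F m y -> F (n + m)%N (br x y)].

Definition is_RB_weight1 (br : g -> g -> g) (R : g -> g) : Prop :=
  (forall a x y, R (a *: x + y) = a *: R x + R y) /\
  (forall x y, br (R x) (R y) = R (br (R x) y + br x (R y) + br x y)).

Definition filtration_preserving (F : nat -> g -> Prop) (R : g -> g) : Prop :=
  forall n x, (1 <= n)%N -> F n x -> F n (R x).

Definition is_lie_map (A : algType K) (br : g -> g -> g) (f : g -> A) : Prop :=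
  (forall a x y, f (a *: x + y) = a *: f x + f y) /\
  (forall x y, f (br x y) = f x * f y - f y * f x).

Definition is_alg_morph (A B : algType K) (phi : A -> B) : Prop :=
  [/\ forall a u v, phi (a *: u + v) = a *: phi u + phi v,
      phi 1 = 1 &
      forall u v, phi (u * v) = phi u * phi v].

Definition is_enveloping (U : algType K) (br : g -> g -> g) (iota : g -> U) : Prop :=
  is_lie_map br iota /\
  forall (A : algType K) (f : g -> A), is_lie_map br f ->
    exists phi : U -> A,
      [/\ is_alg_morph phi,
          (forall x, phi (iota x) = f x) &
          forall psi : U -> A, is_alg_morph psi -> (forall x, psi (iota x) = f x) ->
             forall u, psi u = phi u].

Variable U : algType K.

Definition monomial (iota : g -> U) (xs : seq (nat * g)) : U :=
  \prod_(p <- xs) iota p.2.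

Definition admissible (F : nat -> g -> Prop) (n : nat) (xs : seq (nat * g)) : Prop :=
  [/\ (0 < size xs)%N,
      (forall p, p \in xs -> (1 <= p.1)%N /\ F p.1 p.2) &
      (n <= \sum_(p <- xs) p.1)%N].

Definition FU (F : nat -> g -> Prop) (iota : g -> U) (n : nat) (u : U) : Prop :=
  n = 0%N \/
  exists s : seq (K * seq (nat * g)),
    (forall t, t \in s -> admissible F n t.2) /\
    u = \sum_(t <- s) t.1 *: monomial iota t.2.

(* Elements of \hat U(g) = lim U/F_n U are represented by coherent sequences
   u : nat -> U (u n represents the component in U/F_n U); equality is
   componentwise congruence. *)
Definition coherentU F iota (u : nat -> U) : Prop :=
  forall n, FU F iota n (u n.+1 - u n).
Definition eqU F iota (u v : nat -> U) : Prop :=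
  forall n, FU F iota n (u n - v n).

(* Elements of \hat g = lim g/F_{n+1} g: coherent sequences x : nat -> g
   (x n represents the component in g/F_{n+1} g). *)
Definition ghat_coherent (F : nat -> g -> Prop) (x : nat -> g) : Prop :=
  forall n, F n.+2 (x n.+1 - x n).
Definition eqg (F : nat -> g -> Prop) (x y : nat -> g) : Prop :=
  forall n, F n.+1 (x n - y n).

Definition embed (iota : g -> U) (x : nat -> g) : nat -> U := fun n => iota (x n).

Definition Rhat (R : g -> g) (x : nat -> g) : nat -> g := fun n => R (x n).

Definition Rcalhat (Rc : U -> U) (u : nat -> U) : nat -> U := fun n => Rc (u n).

(* exp(u) = sum_k u^k/k!, truncated in component n (terms k >= n lie in F_n) *)
Definition expU (u : nat -> U) : nat -> U :=
  fun n => \sum_(k < n) (k`!%:R)^-1 *: (u n) ^+ k.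

(* left star-multiplication by a primitive element y of g:
   y * b = y_(1) R(y_(2)) b S(R(y_(3))) = y b + R(y) b - b R(y) *)
Definition starL (R : g -> g) (iota : g -> U) (y : g) (b : U) : U :=
  iota y * b + (iota (R y) * b - b * iota (R y)).

Definition exp_star (R : g -> g) (iota : g -> U) (x : nat -> g) : nat -> U :=
  fun n => \sum_(k < n) (k`!%:R)^-1 *: iter k (starL R iota (x n)) 1.

Definition is_Rcal (R : g -> g) (iota : g -> U) (Rc : U -> U) : Prop :=
  [/\ forall a u v, Rc (a *: u + v) = a *: Rc u + Rc v,
      Rc 1 = 1,
      forall x, Rc (iota x) = iota (R x) &
      forall x h, Rc (iota x * h) =
                  iota (R x) * Rc h - Rc (iota (R x) * h - h * iota (R x))].

End Defs.

(* Main.v *)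
(* The recursion R(xh) = R(x) R(h) - R([R(x), h]) says exactly that Rc turns left
   star-multiplication by y into left multiplication by R(y).  Hence
   Rc(exp_star y) = exp(R y), and since Rc preserves the filtration,
   exp z = Rc(exp x) = Rc(exp_star y) = exp(R y).  It remains to show that exp is
   injective on the completion of g, which reduces degree by degree to a filtered
   Poincare-Birkhoff-Witt statement: x in g lies in F_n g as soon as it lies in
   F_n U(g).

   For the latter one builds the canonical projection U(g) -> g, which sends
   x_1 ... x_k to the coefficient of t_1 ... t_k in log(e^(t_1 x_1) ... e^(t_k x_k)).
   It is a function on words; such functions form a Lie algebra Hom(T(g), g) under
   convolution, in which prefixing a letter x acts as a derivation d_x, and the
   projection p is characterised by p(1) = 0 and psi(ad p)(d_x p) = x, where
   psi(t) = (e^t - 1)/t.  The Maurer-Cartan identity for psi gives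
   d_y d_x p - d_x d_y p = d_[x,y] p, so p does factor through U(g), and it maps
   F_n U(g) to F_n g because it is built from brackets. *)
Require Import Defs.
From HB Require Import structures.
From mathcomp Require Import all_boot all_order all_algebra.
From mathcomp Require Import boolp functions.
Set Implicit Arguments. Unset Strict Implicit. Unset Printing Implicit Defensive.
Import Order.TTheory GRing.Theory Num.Theory.
Local Open Scope ring_scope.

(** Cauchy product of two truncated series, regrouped by antidiagonals m = j + k. *)
Lemma sum_square_triangle (V : nmodType) N (f : nat -> nat -> V) :
    (forall j k, (N <= j + k)%N -> f j k = 0) ->
  \sum_(j < N) \sum_(k < N) f j k = \sum_(m < N) \sum_(j < m.+1) f j (m - j)%N.
Proof.
move=> f0.
under [RHS]eq_bigr => m _ do rewrite (big_ord_widen N (fun j => f j (m - j)%N)) //.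
rewrite [RHS](exchange_big_dep predT) //=; apply: eq_bigr => j _.
transitivity (\sum_(j <= m < N) f j (m - j)%N); last first.
  by rewrite (@big_nat_widenl _ _ _ j 0 N predT) // big_mkord.
rewrite -[nat_of_ord j in RHS]add0n big_addn big_mkord.
under [RHS]eq_bigr => k _ do rewrite addnK.
rewrite [RHS](big_ord_widen N (f j)) ?leq_subr // [RHS]big_mkcond /=.
by apply: eq_bigr => k _; rewrite ltn_subRL; case: ltnP => // /f0.
Qed.

(** * The Lie algebra Hom(T(g), g) *)

Section ConvolutionBracket.
Variables (K : fieldType) (g : lmodType K) (br : g -> g -> g).
Hypothesis hbr : is_lie_bracket br.
Hypothesis hK : [pchar K] =i pred0.
Local Notation L := (seq g -> g).

Lemma br_linear x : linear (br x).
Proof. by case: hbr => _ br_linr _ _ a y z; rewrite br_linr. Qed.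

HB.instance Definition _ x := GRing.isLinear.Build K g g *:%R (br x) (br_linear x).

Lemma brC x y : br x y = - br y x.
Proof.
case: hbr => brl _ brxx _; apply/eqP; rewrite -addr_eq0.
have brDl u v z : br (u + v) z = br u z + br v z.
  by rewrite -[u]scale1r brl !scale1r.
by have := brxx (x + y); rewrite linearD/= !brDl !brxx addr0 add0r addrC => ->.
Qed.

Lemma br_leibniz x y z : br x (br y z) = br (br x y) z + br y (br x z).
Proof.
case: hbr => _ _ _ /(_ x y z) /eqP.
rewrite -addrA addr_eq0 => /eqP ->.
by rewrite opprD (brC z (br x y)) opprK (brC z x) linearN opprK addrC.
Qed.

Definition shift (x : g) (a : L) : L := fun w => a (x :: w).

Lemma shift_linear x : linear (shift x).
Proof. by []. Qed.

HB.instance Definition _ x :=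
  GRing.isLinear.Build K L L *:%R (shift x) (shift_linear x).

Fixpoint conv_rec (w : seq g) (a b : L) : g :=
  if w is x :: w' then conv_rec w' (shift x a) b + conv_rec w' a (shift x b)
  else br (a [::]) (b [::]).

(* The bracket of Hom(T(g), g) given by the unshuffle coproduct of T(g): on a
   word w it sums [a(u), b(v)] over the splittings of w into complementary
   subwords u, v.  The recursion says that every [shift x] is a derivation. *)
Definition conv (a b : L) : L := fun w => conv_rec w a b.

Lemma shift_conv x a b :
  shift x (conv a b) = conv (shift x a) b + conv a (shift x b).
Proof. by []. Qed.

Lemma conv_linear a : linear (conv a).
Proof.
move=> c b b'; apply/funext => w; rewrite /conv.
elim: w a b b' => [|x w IHw] a b b' /=; first exact: linearP.
by rewrite linearP !IHw addrACA -scalerDr.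
Qed.

HB.instance Definition _ a :=
  GRing.isLinear.Build K L L *:%R (conv a) (conv_linear a).

Lemma convC a b : conv a b = - conv b a.
Proof.
apply/funext => w; rewrite /conv.
elim: w a b => [|x w IHw] a b /=; first exact: brC.
by rewrite IHw (IHw a) -opprD addrC.
Qed.

Lemma convDl a a' b : conv (a + a') b = conv a b + conv a' b.
Proof. by rewrite convC linearD opprD -!convC. Qed.

Lemma convZl c a b : conv (c *: a) b = c *: conv a b.
Proof. by rewrite convC linearZ -scalerN -convC. Qed.

Lemma convNl a b : conv (- a) b = - conv a b.
Proof. by rewrite convC linearN -(convC a b). Qed.

Lemma convBl a a' b : conv (a - a') b = conv a b - conv a' b.
Proof. by rewrite convDl convNl. Qed.

Lemma conv_suml (I : Type) (r : seq I) (f : I -> L) b :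
  conv (\sum_(i <- r) f i) b = \sum_(i <- r) conv (f i) b.
Proof. rewrite convC linear_sum -sumrN; apply: eq_bigr => i _; by rewrite -convC. Qed.

(** Induction on the word: each [shift x] is a derivation, so both sides obey the same recursion,
    and the empty word is the Jacobi identity of [br]. *)
Lemma conv_leibniz a b c : conv a (conv b c) = conv (conv a b) c + conv b (conv a c).
Proof.
apply/funext => w.
elim: w a b c => [|x w IHw] a b c; first exact: br_leibniz.
have shift_eq (h k : L) : shift x h w = shift x k w -> h (x :: w) = k (x :: w) by [].
apply: shift_eq; rewrite linearD/= !shift_conv !linearD/= !convDl.
have fctD (h k : L) : (h + k) w = h w + k w by [].
rewrite !fctD (IHw (shift x a)) (IHw a (shift x b)) (IHw a b (shift x c)) !fctD.
by rewrite [LHS](AC (2 * (2 * 2)) ((1 * 3 * 5) * (4 * (2 * 6)))).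
Qed.


Section Derivation.
Variable a : L.
Local Notation D := (conv a).

Definition ad_pow n (b : L) : L := iter n D b.

Lemma ad_powS n b : ad_pow n.+1 b = D (ad_pow n b).
Proof. by []. Qed.

Lemma ad_powD m n b : ad_pow (m + n) b = ad_pow m (ad_pow n b).
Proof. exact: iterD. Qed.

Lemma ad_pow_linear n : linear (ad_pow n).
Proof. by elim: n => [|n IHn] c b b' //; rewrite !ad_powS IHn linearP. Qed.

HB.instance Definition _ n :=
  GRing.isLinear.Build K L L *:%R (ad_pow n) (ad_pow_linear n).

(* The homogeneous part of degree m of the Maurer-Cartan identity, with
   denominators cleared: writing [p], [q] for the actions of [D] on [u] and [v],
   it is the coefficient identity behind
   (psi(p+q) - psi(q))/p + (psi(p+q) - psi(p))/q = psi(p) psi(q),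
   where psi(t) = (e^t - 1)/t. *)
Lemma maurer_cartan_homogeneous m u v :
  \sum_(i < m.+1) ad_pow i (conv u (ad_pow (m - i) v) - conv v (ad_pow (m - i) u))
  = \sum_(j < m.+1) conv (ad_pow j u) (ad_pow (m - j) v) *+ 'C(m.+2, j.+1).
Proof.
elim: m => [|m IHm].
  by rewrite !big_ord_recl !big_ord0 !addr0 /= (convC v) opprK -mulr2n.
(* The terms with i > 0 are [D] of the sum in degree m, and [D] acts on brackets by Leibniz. *)
rewrite big_ord_recl subn0.
under eq_bigr => i _ do rewrite lift0 ad_powS subSS.
rewrite -linear_sum IHm linear_sum /=.
pose G j := conv (ad_pow j u) (ad_pow (m.+1 - j) v).
under eq_bigr => j _.
  rewrite raddfMn /= conv_leibniz -[conv _ (ad_pow (m - j) v)]/(conv (ad_pow j.+1 u) _).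
  rewrite -(subSS j m) -/(G j.+1) -ad_powS -subSn ?leq_ord // -/(G j) mulrnDl.
  over.
rewrite big_split /=.
(* Pascal's rule produces the two sums given by Leibniz; the two extra boundary terms are those of i
   = 0. *)
have -> : \sum_(j < m.+2) conv (ad_pow j u) (ad_pow (m.+1 - j) v) *+ 'C(m.+3, j.+1)
    = \sum_(j < m.+2) G j *+ 'C(m.+2, j.+1) + \sum_(j < m.+2) G j *+ 'C(m.+2, j).
  by rewrite -big_split; apply: eq_bigr => j _; rewrite binS mulrnDr.
rewrite [X in _ = X + _]big_ord_recr /= binn [X in _ = _ + X]big_ord_recl bin0 /=.
by rewrite (convC v) opprK /G subnn /= [RHS](AC (2 * 2) ((3 * 2) * (4 * 1))) /=.
Qed.
End Derivation.
Arguments ad_pow : simpl never.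

(** The filtration by word length. If [a [::] = 0], bracketing with [a] raises the order by one, so
    N terms of a series in ad(a) suffice modulo [vanishes N]. *)
Definition vanishes N (a : L) : Prop := forall w, (size w < N)%N -> a w = 0.

Lemma vanishes_subspace N : is_subspace (vanishes N).
Proof.
split=> [//|c a b a0 b0 w wN].
by rewrite -[LHS]/(c *: a w + b w) a0 // b0 // scaler0 addr0.
Qed.

Lemma vanishes_leq M N a : (M <= N)%N -> vanishes N a -> vanishes M a.
Proof. by move=> MN a0 w wM; rewrite a0 // (leq_trans wM). Qed.

Lemma vanishes_shift N x a : vanishes N a -> vanishes N.-1 (shift x a).
Proof. by move=> a0 w wN; apply: a0; case: N wN. Qed.

Lemma vanishes_conv p q a b : vanishes p a -> vanishes q b -> vanishes (p + q) (conv a b).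
Proof.
move=> a0 b0 w; rewrite /conv.
elim: w p q a b a0 b0 => [|x w IHw] p q a b a0 b0 /=.
  case: p a0 => [|p] a0 => [q0|_]; first by rewrite b0 // linear0.
  by rewrite a0 // brC linear0 oppr0.
move=> wpq; rewrite (IHw p.-1 q) 1?(IHw p q.-1) ?addr0 //.
- exact: vanishes_shift.
- by case: q wpq {b0} => [|q] //; rewrite ?addn0 ?addnS // => /ltnW.
- exact: vanishes_shift.
- by case: p wpq {a0} => [|p] // /ltnW.
Qed.

Lemma subspaceD (V : lmodType K) (C : V -> Prop) a b :
  is_subspace C -> C a -> C b -> C (a + b).
Proof. by move=> [_ CL] Ca Cb; rewrite -[a]scale1r; apply: CL. Qed.

Lemma subspaceZ (V : lmodType K) (C : V -> Prop) c a : is_subspace C -> C a -> C (c *: a).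
Proof. by move=> [C0 CL] Ca; rewrite -[_ *: a]addr0; apply: CL. Qed.

Lemma subspaceN (V : lmodType K) (C : V -> Prop) a : is_subspace C -> C a -> C (- a).
Proof. by move=> CV Ca; rewrite -scaleN1r; apply: subspaceZ. Qed.

Lemma subspaceB (V : lmodType K) (C : V -> Prop) a b :
  is_subspace C -> C a -> C b -> C (a - b).
Proof. by move=> CV Ca Cb; apply: subspaceD => //; apply: subspaceN. Qed.

Lemma subspace_sum (V : lmodType K) (C : V -> Prop) (I : eqType) (r : seq I)
    (P : pred I) (f : I -> V) :
  is_subspace C -> (forall i, i \in r -> P i -> C (f i)) -> C (\sum_(i <- r | P i) f i).
Proof.
move=> CV Cf; rewrite big_seq_cond; apply: (big_ind C) => [|a b|i /andP[]].
- by case: CV.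
- exact: subspaceD.
- exact: Cf.
Qed.

Lemma subspace_subr (V : lmodType K) (C : V -> Prop) a b :
  is_subspace C -> C (a - b) -> C b -> C a.
Proof. by move=> CV Cab Cb; rewrite -(subrK b a); apply: subspaceD. Qed.

Definition psi n : K := (n.+1`!%:R)^-1.

(** Both sides are 1/((j+1)! (m-j+1)!): these coefficients absorb the binomials of
    [maurer_cartan_homogeneous]. Characteristic zero allows the cancellation. *)
Lemma psiM m (j : 'I_m.+1) : psi j * psi (m - j) = psi m.+1 * 'C(m.+2, j.+1)%:R.
Proof.
have jm : (j.+1 <= m.+2)%N by rewrite ltnS ltnW.
have bin_neq0 : 'C(m.+2, j.+1)%:R != 0 :> K by rewrite (pcharf0P K).1 // -lt0n bin_gt0.
rewrite /psi -(bin_fact jm) subSS subSn ?leq_ord // !natrM !invfM.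
by rewrite [RHS]mulrC mulVKf.
Qed.

Lemma psi0 : psi 0 = 1.
Proof. exact: invr1. Qed.

(** * Series in the adjoint action *)

Section Descent.
Variables (a : L) (N : nat).
Hypothesis a_nil : a [::] = 0.

Lemma vanishes1 : vanishes 1 a.
Proof. by case. Qed.

Lemma vanishes_ad_pow n m b : vanishes m b -> vanishes (n + m) (ad_pow a n b).
Proof.
move=> b0; elim: n => [//|n IHn]; rewrite ad_powS addSn -add1n.
exact: vanishes_conv vanishes1 IHn.
Qed.

Definition psi_ad b : L := \sum_(n < N) psi n *: ad_pow a n b.

(* [psi_ad] is unipotent, so b lies in the [ad a]-stable span of [psi_ad b]:
   show by downward induction on m that [ad_pow a m b] is in C. *)
Lemma psi_ad_descent (C : L -> Prop) b :
    is_subspace C -> (forall c, vanishes N c -> C c) -> (forall c, C c -> C (conv a c)) ->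
  C (psi_ad b) -> C b.
Proof.
move=> CS CV CD CP.
have CDn n c : C c -> C (ad_pow a n c) by move=> Cc; elim: n => [//|n]; apply: CD.
suff H j m : (N <= m + j)%N -> C (ad_pow a m b) by apply: (H N 0%N).
elim: j m => [|j IHj] m; rewrite ?addn0 ?addnS => Nmj.
  apply: CV; apply: vanishes_leq Nmj _; rewrite -[m in vanishes m]addn0.
  exact: vanishes_ad_pow.
(* The leading term is [ad_pow a m b] with coefficient [psi 0 = 1]; the others are higher powers,
   already in [C] by induction. *)
have := CDn m _ CP; rewrite /psi_ad linear_sum /=.
case: (N) Nmj CV IHj => [|N'] Nmj CV IHj; first by move=> _; apply: CV.
rewrite big_ord_recl psi0 scale1r /=; set r := \sum_(i < N') _ => Cr.
rewrite -[ad_pow _ _ _](addrK r); apply: subspaceB => //.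
apply: subspace_sum => // i _ _; rewrite linearZ /= -ad_powD.
apply: (subspaceZ _ CS); apply: IHj.
by rewrite (leq_trans Nmj) // /bump add1n addnS addSn ltnS addnAC leq_addr.
Qed.


(** On the triangle j + k < N this is the homogeneous identity degree by degree; the other terms of
    the square contain at least N brackets with [a]. *)
Lemma vanishes_psi_ad_comm u v :
  vanishes N (conv (psi_ad u) (psi_ad v)
    - \sum_(m < N) psi m.+1 *:
        \sum_(i < m.+1) ad_pow a i
          (conv u (ad_pow a (m - i) v) - conv v (ad_pow a (m - i) u))).
Proof.
pose F j k := (psi j * psi k) *: conv (ad_pow a j u) (ad_pow a k v).
have -> : conv (psi_ad u) (psi_ad v) = \sum_(j < N) \sum_(k < N) F j k.
  rewrite conv_suml; apply: eq_bigr => j _; rewrite linear_sum; apply: eq_bigr => k _.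
  by rewrite /= convZl linearZ scalerA.
under [X in _ - X]eq_bigr => m _.
  rewrite maurer_cartan_homogeneous scaler_sumr.
  under eq_bigr => j _.
    rewrite -scaler_nat scalerA -psiM -/(F j (m - j)%N); over.
  over.
move=> w wN; rewrite -[LHS]/((\sum_(j < N) _) w - (\sum_(m < N) _) w) !fct_sumE.
under eq_bigr => j _ do rewrite fct_sumE.
under [X in _ - X]eq_bigr => m _ do rewrite fct_sumE.
rewrite (@sum_square_triangle _ N (fun j k => F j k w)) ?subrr // => j k Njk.
have V0 n b : vanishes n (ad_pow a n b).
  by rewrite -[n in vanishes n]addn0; apply: vanishes_ad_pow.
rewrite -[LHS]/((psi j * psi k) *: conv (ad_pow a j u) (ad_pow a k v) w).
by rewrite (vanishes_conv (V0 j u) (V0 k v)) ?scaler0 // (leq_trans wN).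
Qed.

End Descent.

Section ShiftAdPow.
Variable a : L.

(** Leibniz rule: x is absorbed by [b] or by one of the n copies of [a], the one preceded by i
    others. *)
Lemma shift_ad_pow x n b :
  shift x (ad_pow a n b) = ad_pow a n (shift x b)
    + \sum_(i < n) ad_pow a i (conv (shift x a) (ad_pow a (n.-1 - i) b)).
Proof.
elim: n => [|n IHn]; first by rewrite big_ord0 addr0.
rewrite ad_powS shift_conv IHn linearD /= -ad_powS addrCA; congr (_ + _).
rewrite big_ord_recl subn0; congr (_ + _); rewrite linear_sum.
by apply: eq_bigr => i _; case: n {IHn} i => [[]|n] i //; rewrite lift0 subSS.
Qed.

End ShiftAdPow.

(** * The projection of the enveloping algebra onto the Lie algebra *)

(** The copy of g in Hom(T(g), g): these functions are constants for all the derivations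
    [shift y]. *)
Definition letter (x : g) : L := fun w => if w is [::] then x else 0.

Lemma shift_letter x y : shift y (letter x) = 0.
Proof. by []. Qed.

Lemma conv0l b : conv 0 b = 0.
Proof. by rewrite convC linear0 oppr0. Qed.

Lemma conv_letter x y : conv (letter x) (letter y) = letter (br x y).
Proof.
apply/funext => -[|z w] //.
rewrite -[LHS]/(shift z (conv (letter x) (letter y)) w) shift_conv !shift_letter.
by rewrite conv0l linear0 addr0.
Qed.

(* [euler_step a = a] says that [psi(ad a) (shift x a) = letter x] for all x,
   where psi(t) = (e^t - 1)/t; the values on shorter words determine those on
   longer ones. *)
Definition euler_step (a : L) : L := fun w =>
  if w is x :: w' then
    letter x w' - \sum_(n < size w') psi n.+1 *: ad_pow a n.+1 (shift x a) w'
  else 0.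

(** At least one bracket with a function that is zero on the empty word gains the order that [shift]
    loses. *)
Lemma vanishes_ad_pow_diff k n a b u v : a [::] = 0 -> b [::] = 0 ->
  vanishes k (a - b) -> vanishes k.-1 (u - v) ->
  vanishes k (ad_pow a n.+1 u - ad_pow b n.+1 v).
Proof.
move=> a0 b0 abk uvk.
suff step c d : vanishes k.-1 (c - d) -> vanishes k (conv a c - conv b d).
  elim: n => [|n IHn]; first exact: step.
  by rewrite ad_powS (ad_powS b); apply/step/(vanishes_leq _ IHn)/leq_pred.
move=> cdk.
have -> : conv a c - conv b d = conv a (c - d) + conv (a - b) d.
  by rewrite linearB convBl /= addrA subrK.
apply: (subspaceD (vanishes_subspace k)).
  apply: (@vanishes_leq _ (1 + k.-1)); first by case: (k).
  by apply: vanishes_conv => //; apply: vanishes1.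
by rewrite -[k in vanishes k]addn0; apply: vanishes_conv.
Qed.

Lemma euler_step_contract k a b : a [::] = 0 -> b [::] = 0 ->
  vanishes k (a - b) -> vanishes k.+1 (euler_step a - euler_step b).
Proof.
move=> a0 b0 abk [|x w] wk; first exact: subr0.
rewrite -[LHS]/(euler_step a (x :: w) - euler_step b (x :: w)) /= opprD addrACA subrr add0r.
rewrite opprK addrC -sumrB big1 // => n _; rewrite -scalerBr -opprB.
rewrite -[X in - X]/((ad_pow a n.+1 (shift x a) - ad_pow b n.+1 (shift x b)) w).
rewrite (vanishes_ad_pow_diff n a0 b0 abk) ?oppr0 ?scaler0 //.
by rewrite -linearB; apply: vanishes_shift.
Qed.

Definition euler_approx k : L := iter k euler_step 0.

(** The limit of the iterates: each step settles one more word length, so the iterate numbered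
    [size w] is already final on [w]. *)
Definition euler_proj : L := fun w => euler_approx (size w) w.
Arguments euler_proj : simpl never.
Arguments shift : simpl never.

Lemma euler_approx_nil k : euler_approx k [::] = 0.
Proof. by case: k. Qed.

Lemma euler_nil : euler_proj [::] = 0.
Proof. by []. Qed.

Lemma euler_approxS k : vanishes k.+1 (euler_approx k.+1 - euler_approx k).
Proof.
elim: k => [[|//] _|k IHk]; first exact: subr0.
by apply: euler_step_contract IHk; apply: euler_approx_nil.
Qed.

Lemma euler_approxP k w : (size w <= k)%N -> euler_approx k w = euler_proj w.
Proof.
elim: k => [|k IHk]; first by rewrite leqn0 => /eqP w0; rewrite /euler_proj w0.
rewrite leq_eqVlt => /predU1P[<- //|wk].
by rewrite -IHk //; apply/eqP; rewrite -subr_eq0; apply/eqP/(euler_approxS (k := k)).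
Qed.

Lemma vanishes_euler_approx k : vanishes k.+1 (euler_proj - euler_approx k).
Proof. by move=> w wk; rewrite -[LHS]/(euler_proj w - euler_approx k w) euler_approxP ?subrr. Qed.

Lemma euler_fix : euler_step euler_proj = euler_proj.
Proof.
apply/funext => w.
have /(_ w) := euler_step_contract euler_nil (euler_approx_nil (size w))
  (vanishes_euler_approx (k := size w)).
move=> /(_ (leqW (leqnn _)))/eqP; rewrite subr_eq0 => /eqP ->.
by rewrite -[LHS]/(euler_approx (size w).+1 w) euler_approxP.
Qed.

(** The fixed-point equation, with a truncation independent of the word: powers beyond [size w]
    vanish on [w]. *)
Lemma psi_ad_shift_euler_proj N x : vanishes N (psi_ad euler_proj N (shift x euler_proj) - letter x).
Proof.
move=> w wN; rewrite -[LHS]/(psi_ad euler_proj N (shift x euler_proj) w - letter x w) /psi_ad fct_sumE.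
case: N wN => // N' wN; rewrite -(subnKC (wN : (size w <= N')%N)) -addnS.
rewrite -addSnnS big_split_ord big_ord_recl /= psi0.
have -> : (1 *: ad_pow euler_proj 0 (shift x euler_proj)) w = euler_step euler_proj (x :: w).
  by rewrite scale1r euler_fix.
rewrite /= subrK big1 ?addr0 ?subrr // => i _.
rewrite -[LHS]/(psi _ *: ad_pow euler_proj _ (shift x euler_proj) w).
have := @vanishes_ad_pow euler_proj euler_nil ((size w).+1 + i) 0 (shift x euler_proj).
by rewrite addn0 => -> //; [rewrite scaler0 | rewrite addSn ltnS leq_addr].
Qed.

Lemma psi_ad_linear a N : linear (psi_ad a N).
Proof.
move=> c b b'; rewrite /psi_ad scaler_sumr -big_split; apply: eq_bigr => n _.
by rewrite linearP scalerDr /= !scalerA mulrC.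
Qed.

HB.instance Definition _ a N :=
  GRing.isLinear.Build K L L *:%R (psi_ad a N) (psi_ad_linear a N).

(** The correction is the derivative of psi(ad a) along x. The term n = 0 contributes nothing to it,
    whence n = m + 1 and [psi m.+1]. *)
Lemma shift_psi_ad a N x b :
  shift x (psi_ad a N.+1 b) = psi_ad a N.+1 (shift x b)
    + \sum_(m < N) psi m.+1 *:
        \sum_(i < m.+1) ad_pow a i (conv (shift x a) (ad_pow a (m - i) b)).
Proof.
rewrite /psi_ad linear_sum /=.
under eq_bigr => n _ do rewrite linearZ /= shift_ad_pow scalerDr.
rewrite big_split /=; congr (_ + _).
by rewrite big_ord_recl big_ord0 scaler0 add0r.
Qed.

(** Apply psi(ad p) to the defect, with p = [euler_proj]. Moving the shifts outside leaves
    derivatives of letters, which are zero, and corrections that combine into -[y, x] by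
    [vanishes_psi_ad_comm]; this cancels the letter [x, y]. Unipotence of psi(ad p) then kills the
    defect. *)
Lemma shift_euler_commutator x y :
  shift y (shift x euler_proj) - shift x (shift y euler_proj) = shift (br x y) euler_proj.
Proof.
apply/eqP; rewrite -subr_eq0; apply/eqP/funext => w; set N := (size w).+1.
suff /(_ w (leqnn _)) : vanishes N (shift y (shift x euler_proj)
  - shift x (shift y euler_proj) - shift (br x y) euler_proj) by [].
have VN := vanishes_subspace N.
(* One term more than N, because [shift] costs one order of vanishing. *)
apply: (@psi_ad_descent euler_proj N.+1 euler_nil (vanishes N)) => //.
- by move=> c; apply: vanishes_leq.
- by move=> c /(vanishes_conv (vanishes1 euler_nil)); apply: vanishes_leq.
pose u := shift y euler_proj; pose v := shift x euler_proj.
have Vshift x' y' : vanishes N (shift y' (psi_ad euler_proj N.+1 (shift x' euler_proj))).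
  have := vanishes_shift y' (@psi_ad_shift_euler_proj N.+1 x').
  by rewrite linearB /= shift_letter subr0.
have Vletters : vanishes N (conv (psi_ad euler_proj N u) (psi_ad euler_proj N v) + letter (br x y)).
  have -> : letter (br x y) = - conv (letter y) (letter x).
    by rewrite convC opprK conv_letter.
  set P := psi_ad euler_proj N.
  have -> : conv (P u) (P v) - conv (letter y) (letter x)
      = conv (P u - letter y) (P v) + conv (letter y) (P v - letter x).
    by rewrite convBl linearB /= addrA subrK.
  apply: (subspaceD VN) => //.
    by rewrite -[N]addn0; apply: vanishes_conv => //; apply: psi_ad_shift_euler_proj.
  by rewrite -[N]add0n; apply: vanishes_conv => //; apply: psi_ad_shift_euler_proj.
have Vz : vanishes N (psi_ad euler_proj N.+1 (shift (br x y) euler_proj) - letter (br x y)).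
  by apply: (@vanishes_leq _ N.+1) => //; apply: psi_ad_shift_euler_proj.
have Vcomm := @vanishes_psi_ad_comm euler_proj N euler_nil u v.
pose G u' v' := \sum_(m < N) psi m.+1 *:
  \sum_(i < m.+1) ad_pow euler_proj i (conv u' (ad_pow euler_proj (m - i) v')).
have psi_ad_shift x' c :
    psi_ad euler_proj N.+1 (shift x' c)
    = shift x' (psi_ad euler_proj N.+1 c) - G (shift x' euler_proj) c.
  by rewrite shift_psi_ad addrK.
have {}Vcomm : vanishes N (conv (psi_ad euler_proj N u) (psi_ad euler_proj N v) - (G u v - G v u)).
  congr (vanishes N (_ - _)): Vcomm; rewrite -sumrB; apply: eq_bigr => m _.
  rewrite -scalerBr -sumrB; congr (_ *: _); apply: eq_bigr => i _.
  by rewrite linearB.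
rewrite 2!(linearB (psi_ad euler_proj N.+1)) /= (psi_ad_shift y v) (psi_ad_shift x u) -/u -/v.
move: (Vshift x y) (Vshift y x) Vletters Vz Vcomm; rewrite -/u -/v.
set A1 := shift y _; set A2 := shift x _; set Z := psi_ad euler_proj N.+1 _; set C := conv _ _.
set l := letter _; set G1 := G u v; set G2 := G v u => VA1 VA2 VCl VZl VCG.
have -> : A1 - G1 - (A2 - G2) - Z = A1 - A2 + (C - (G1 - G2) - (C + l) - (Z - l)).
  rewrite (opprD C) (addrACA C) subrr add0r (opprB Z) [X in _ = _ + X]addrA subrK [RHS]addrA.
  by congr (_ - Z); rewrite !opprB (AC (2 * 2) ((1 * 4) * (3 * 2))).
by apply: (subspaceD VN) => //; do !apply: (subspaceB VN) => //.
Qed.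



Lemma euler_step_cons a x w :
  euler_step a (x :: w)
  = (letter x - \sum_(n < size w) psi n.+1 *: ad_pow a n.+1 (shift x a)) w.
Proof. by rewrite -[RHS]/(letter x w - (\sum_(n < _) _) w) fct_sumE. Qed.

(** * Multilinearity and compatibility with the bracket *)

Definition multilinear (a : L) : Prop := forall p q c x y,
  a (p ++ (c *: x + y) :: q) = c *: a (p ++ x :: q) + a (p ++ y :: q).

Lemma multilinear_subspace : is_subspace multilinear.
Proof.
split=> [p q c x y|d a b Ma Mb p q c x y]; first by rewrite scaler0 addr0.
have E w : (d *: a + b) w = d *: a w + b w by [].
by rewrite !E Ma Mb !scalerDr !scalerA mulrC addrACA.
Qed.

Lemma multilinear_shift x a : multilinear a -> multilinear (shift x a).
Proof. by move=> Ma p; apply: (Ma (x :: p)). Qed.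

Lemma multilinear_shiftP a c x y : multilinear a ->
  shift (c *: x + y) a = c *: shift x a + shift y a.
Proof. by move=> Ma; apply/funext => w; apply: (Ma [::]). Qed.

Lemma multilinear_conv a b : multilinear a -> multilinear b -> multilinear (conv a b).
Proof.
move=> Ma Mb p; elim: p a b Ma Mb => [|z p IHp] a b Ma Mb q c x y.
  have E v : conv a b (v :: q) = (conv (shift v a) b + conv a (shift v b)) q by [].
  rewrite !cat0s !E !multilinear_shiftP // convDl convZl linearP /=.
  by rewrite addrACA -scalerDr.
have E v : conv a b ((z :: p) ++ v :: q) =
  conv (shift z a) b (p ++ v :: q) + conv a (shift z b) (p ++ v :: q) by [].
rewrite !E !IHp //; try exact: multilinear_shift.
by rewrite addrACA -scalerDr.
Qed.

Lemma multilinear_ad_pow a n b : multilinear a -> multilinear b -> multilinear (ad_pow a n b).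
Proof. by move=> Ma Mb; elim: n => [//|n]; apply: multilinear_conv. Qed.

Lemma letter_cat_cons x p y q : letter x (p ++ y :: q) = 0.
Proof. by case: p. Qed.

Lemma multilinear_letter x : multilinear (letter x).
Proof. by move=> p q c y z; rewrite !letter_cat_cons scaler0 addr0. Qed.

Lemma letterP c x y : letter (c *: x + y) = c *: letter x + letter y.
Proof. by apply/funext => -[|z w] //; rewrite -[RHS]/(c *: 0 + 0) scaler0 addr0. Qed.

Lemma multilinear_euler_step a : multilinear a -> multilinear (euler_step a).
Proof.
move=> Ma [|z p] q c x y.
  rewrite !cat0s !euler_step_cons letterP multilinear_shiftP //.
  under eq_bigr => n _ do rewrite linearP scalerDr /= scalerA mulrC -scalerA.
  rewrite big_split -scaler_sumr /= opprD addrACA.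
  by rewrite -scalerBr.
rewrite !cat_cons !euler_step_cons !size_cat /=.
(* The three words have equal length, so one fixed truncation serves them all and the goal is
   multilinearity of a single function. *)
set N := (size p + _)%N; apply: (_ : multilinear _).
have MS := multilinear_subspace.
apply: (subspaceB MS); first exact: multilinear_letter.
apply: (subspace_sum MS) => n _ _; apply: (subspaceZ _ MS).
by apply: multilinear_ad_pow => //; apply: multilinear_shift.
Qed.

Lemma multilinear_euler_proj : multilinear euler_proj.
Proof.
suff M n : multilinear (euler_approx n).
  by move=> p q c x y; rewrite /euler_proj !size_cat; apply: M.
elim: n => [|n]; first by case: multilinear_subspace.
exact: multilinear_euler_step.
Qed.

(** The relation xy - yx = [x, y], limited to fewer than k surrounding letters so that the proof for
    [euler_proj] can induct on k. *)
Definition lie_compatible k (a : L) : Prop := forall p q x y,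
  (size p + size q < k)%N ->
  a (p ++ x :: y :: q) - a (p ++ y :: x :: q) = a (p ++ br x y :: q).

Lemma lie_compatible_subspace k : is_subspace (lie_compatible k).
Proof.
split=> [p q x y _|d a b Ca Cb p q x y pqk]; first by rewrite subr0.
have E w : (d *: a + b) w = d *: a w + b w by [].
by rewrite !E -Ca // -Cb // opprD addrACA -scalerBr.
Qed.

Lemma vanishes_lie_compatible k a : vanishes k.+2 a -> lie_compatible k a.
Proof. by move=> a0 p q x y pqk; rewrite !a0 ?subr0 // size_cat /= !addnS ?ltnS // ltnW. Qed.

Lemma lie_compatible_leq j k a : (j <= k)%N -> lie_compatible k a -> lie_compatible j a.
Proof. by move=> jk Ca p q x y pqj; apply: Ca; rewrite (leq_trans pqj). Qed.

Lemma lie_compatible_shift k x a : lie_compatible k a -> lie_compatible k.-1 (shift x a).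
Proof. by move=> Ca p q y z pqk; apply: (Ca (x :: p)); case: k pqk {Ca}. Qed.

Lemma vanishes_shift_commutator k a x y : lie_compatible k a ->
  vanishes k (shift y (shift x a) - shift x (shift y a) - shift (br x y) a).
Proof.
move=> Ca w wk; apply/eqP; rewrite -[_ w]/(a (x :: y :: w) - a (y :: x :: w) - a (br x y :: w)).
by rewrite subr_eq0; apply/eqP/(Ca [::]).
Qed.

(** A commutator of derivations is a derivation, hence so is the defect d_y d_x - d_x d_y - d_[x,y]:
    the mixed terms cancel. *)
Lemma lie_compatible_conv k a b :
  lie_compatible k a -> lie_compatible k b -> lie_compatible k (conv a b).
Proof.
move=> Ca Cb p; elim: p k a b Ca Cb => [|z p IHp] k a b Ca Cb q x y pqk.
  have Vab : vanishes k
      (conv (shift y (shift x a) - shift x (shift y a) - shift (br x y) a) b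
      + conv a (shift y (shift x b) - shift x (shift y b) - shift (br x y) b)).
    apply: (subspaceD (vanishes_subspace k)).
      rewrite -[k in vanishes k]addn0; apply: vanishes_conv => //.
      exact: vanishes_shift_commutator.
    rewrite -[k in vanishes k]add0n; apply: vanishes_conv => //.
    exact: vanishes_shift_commutator.
  apply/eqP; rewrite -subr_eq0 -(Vab q) //; apply/eqP.
  rewrite -[LHS]/((shift y (shift x (conv a b)) - shift x (shift y (conv a b))
    - shift (br x y) (conv a b)) q).
  congr (_ q); rewrite !shift_conv !(linearD (shift _)) /= !shift_conv.
  rewrite !convBl !(linearB (conv a)) /=.
  rewrite [RHS]addrACA -opprD; congr (_ - _).
  rewrite [RHS]addrACA -opprD [X in X - _](AC (2 * 2) ((1 * 4) * (2 * 3))).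
  by rewrite [X in _ - X](AC (2 * 2) ((1 * 4) * (3 * 2))) /= [in LHS]opprD [LHS]addrACA subrr addr0.
have E v : conv a b ((z :: p) ++ v) =
  conv (shift z a) b (p ++ v) + conv a (shift z b) (p ++ v) by [].
rewrite !E opprD addrACA !(IHp k.-1) //.
all: try exact: lie_compatible_shift.
all: try by apply: lie_compatible_leq (leq_pred k) _.
all: by case: k pqk {Ca Cb}.
Qed.

(** An empty prefix is [shift_euler_commutator]. Otherwise strip the first letter z: psi(ad p)(d_z
    p) is a letter up to long words, and by induction ad(p) preserves compatibility, so descent
    applies to d_z p. *)
Lemma lie_compatible_euler_proj k : lie_compatible k euler_proj.
Proof.
elim: k => [//|k IHk] [|z p] q x y pqk.
  have /(congr1 (fun f : L => f q)) := shift_euler_commutator x y; exact.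
suff Cz : lie_compatible k (shift z euler_proj) by apply: Cz.
have CS := lie_compatible_subspace k.
apply: (@psi_ad_descent euler_proj k.+2 euler_nil _ _ CS) => [c|c|].
- exact: vanishes_lie_compatible.
- exact: lie_compatible_conv.
apply: (subspace_subr CS (b := letter z)).
  by apply/vanishes_lie_compatible/psi_ad_shift_euler_proj.
by move=> p' q' x' y' _; rewrite !letter_cat_cons subr0.
Qed.

(** * The projection respects the filtration *)

Section Filtration.
Variable F : nat -> g -> Prop.
Hypothesis hF : is_lie_filtration br F.

Lemma filtration_leq m n x : (0 < m)%N -> (m <= n)%N -> F n x -> F m x.
Proof.
case: hF => _ _ FS _ m0; elim: n => [|n IHn]; first by rewrite leqNgt m0.
rewrite leq_eqVlt => /predU1P[<- //|mn] Fn; apply: IHn => //.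
by apply: FS => //; apply: leq_trans m0 mn.
Qed.

Lemma filtration_subspace n : is_subspace (F n.+1).
Proof. by case: hF => _ FV _ _; apply: FV. Qed.

Definition weighted (xs : seq (nat * g)) : Prop :=
  forall p, p \in xs -> (1 <= p.1)%N /\ F p.1 p.2.

Definition weight (xs : seq (nat * g)) : nat := \sum_(p <- xs) p.1.

(* [F n.-1.+1] extends the filtration by F_0 = F_1 = g. *)
Definition filtered d (a : L) : Prop := forall xs, weighted xs ->
  F (d + weight xs).-1.+1 (a (map snd xs)).

Lemma filtered_subspace d : is_subspace (filtered d).
Proof.
split=> [xs _|c a b Fa Fb xs wxs]; first exact: (filtration_subspace _).1.
exact: ((filtration_subspace _).2 c _ _ (Fa _ wxs) (Fb _ wxs)).
Qed.

Lemma filtered_shift d n x a : (0 < n)%N -> F n x -> filtered d a -> filtered (d + n) (shift x a).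
Proof.
move=> n0 Fx Fa xs wxs.
have -> : (d + n + weight xs)%N = (d + weight ((n, x) :: xs))%N.
  by rewrite /weight big_cons addnA.
by apply: (Fa ((n, x) :: xs)) => p; rewrite inE => /predU1P[->//|/wxs].
Qed.

Lemma filtered_conv d e a b : filtered d a -> filtered e b -> filtered (d + e) (conv a b).
Proof.
move=> Fa Fb xs; elim: xs d e a b Fa Fb => [|[n x] xs IHxs] d e a b Fa Fb wxs.
  rewrite /weight big_nil addn0; case: hF => _ _ _ Fbr.
  have w0 : weighted [::] by [].
  (* Degree 0 counts as degree 1, and max(d,1) + max(e,1) is at least max(d+e,1). *)
  have := Fbr _ _ _ _ (ltn0Sn _) (ltn0Sn _) (Fa _ w0) (Fb _ w0).
  apply: filtration_leq => //; rewrite /weight big_nil !addn0 addSn addnS.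
  by case: d {Fa} => [|d]; case: e {Fb} => [|e] //=; rewrite ?addn0 ?addSn ?addnS //.
have [|n0 /= Fx] := wxs (n, x); first exact: mem_head.
have {}wxs : weighted xs by move=> p pxs; apply: wxs; rewrite inE pxs orbT.
have := IHxs _ _ _ _ (filtered_shift n0 Fx Fa) Fb wxs.
have := IHxs _ _ _ _ Fa (filtered_shift n0 Fx Fb) wxs.
have -> : (d + (e + n) + weight xs = d + e + weight ((n, x) :: xs))%N.
  by rewrite /weight big_cons /= !addnA.
have -> : (d + n + e + weight xs = d + e + weight ((n, x) :: xs))%N.
  by rewrite /weight big_cons /= (addnAC d) !addnA.
by move=> H1 H2; exact: (subspaceD (filtration_subspace _) H2 H1).
Qed.

Lemma filtered_letter n x : (0 < n)%N -> F n x -> filtered n (letter x).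
Proof.
move=> n0 Fx [|p xs] _; first by rewrite /weight big_nil addn0 prednK.
exact: (filtration_subspace _).1.
Qed.

Lemma filtered_euler_step a : filtered 0 a -> filtered 0 (euler_step a).
Proof.
move=> Fa [|[n x] xs] wxs; first exact: (filtration_subspace _).1.
have [|n0 Fx] := wxs (n, x); first exact: mem_head.
have {}wxs : weighted xs by move=> p pxs; apply: wxs; rewrite inE pxs orbT.
rewrite map_cons euler_step_cons size_map /weight big_cons /= add0n.
(* The weight of the first letter has become the degree n of a function of the remaining word. *)
apply: (_ : filtered n _) => //; have FS := filtered_subspace n.
apply: (subspaceB FS); first exact: filtered_letter.
apply: (subspace_sum FS) => i _ _; apply: (subspaceZ _ FS).
elim: (i.+1) => [|j IHj]; first by rewrite -[n]add0n; apply: filtered_shift.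
by rewrite -[n]add0n ad_powS; apply: filtered_conv.
Qed.

Lemma filtered_euler_proj : filtered 0 euler_proj.
Proof.
suff Fn n : filtered 0 (euler_approx n) by move=> xs; apply: Fn.
elim: n => [|n]; first by case: (filtered_subspace 0).
exact: filtered_euler_step.
Qed.

End Filtration.

End ConvolutionBracket.

(** * Filtered Poincare-Birkhoff-Witt *)

Section Endomorphisms.
Variables (K : fieldType) (V : lmodType K).

Definition linear_pred : pred (V -> V) := fun f => `[< linear f >].

Lemma linear_pred_submod : submod_closed linear_pred.
Proof.
split=> [|a f h /asboolP fL /asboolP hL]; apply/asboolP => c x y.
  by rewrite -[LHS]/(0 : V) -[_ x]/(0 : V) -[_ y]/(0 : V) scaler0 addr0.
have E z : (a *: f + h) z = a *: f z + h z by [].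
by rewrite !E fL hL !scalerDr !scalerA mulrC addrACA.
Qed.

(* The nonzero vector is what makes the ring of endomorphisms nontrivial. *)
Record endo (v : {v : V | v != 0}) := Endo {
  endo_fun :> V -> V;
  endo_funP : endo_fun \in linear_pred
}.

Variable v : {v : V | v != 0}.
Local Notation E := (endo v).

HB.instance Definition _ := [isSub of E for @endo_fun v].
HB.instance Definition _ := [Choice of E by <:].
HB.instance Definition _ :=
  GRing.SubChoice_isSubLmodule.Build K (V -> V) linear_pred E linear_pred_submod.

Lemma endo_linear (f : E) : linear f.
Proof. by have /asboolP := endo_funP f. Qed.

HB.instance Definition _ (f : E) :=
  GRing.isLinear.Build K V V *:%R f (endo_linear f).

Lemma endoP (f h : E) : f =1 h -> f = h.
Proof. by move=> fh; apply/val_inj/funext. Qed.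

Lemma endo1_subproof : (id : V -> V) \in linear_pred.
Proof. exact/asboolP. Qed.

Lemma endoM_subproof (f h : E) : f \o h \in linear_pred.
Proof. by apply/asboolP => c x y /=; rewrite !linearP. Qed.

Definition endo1 : E := Endo v endo1_subproof.
Definition endo_mul (f h : E) : E := Endo v (endoM_subproof f h).

Lemma endo_mulA : associative endo_mul. Proof. by move=> f h k; apply: endoP. Qed.
Lemma endo_mul1 : left_id endo1 endo_mul. Proof. by move=> f; apply: endoP. Qed.
Lemma endo_1mul : right_id endo1 endo_mul. Proof. by move=> f; apply: endoP. Qed.
Lemma endo_mulDl : left_distributive endo_mul +%R.
Proof. by move=> f h k; apply: endoP. Qed.
Lemma endo_mulDr : right_distributive endo_mul +%R.
Proof. by move=> f h k; apply: endoP => x; exact: linearD. Qed.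
Lemma endo1_neq0 : endo1 != 0.
Proof.
apply/eqP => /(congr1 (fun f : E => f (sval v))) v0.
by have /eqP := svalP v; apply.
Qed.

HB.instance Definition _ := GRing.Zmodule_isNzRing.Build E
  endo_mulA endo_mul1 endo_1mul endo_mulDl endo_mulDr endo1_neq0.

Lemma endo_scalerAl (a : K) (f h : E) : a *: (f * h) = (a *: f) * h.
Proof. exact: endoP. Qed.

HB.instance Definition _ := GRing.Lmodule_isLalgebra.Build K E endo_scalerAl.

Lemma endo_scalerAr (a : K) (f h : E) : a *: (f * h) = f * (a *: h).
Proof. by apply: endoP => x; rewrite [RHS]linearZ. Qed.

HB.instance Definition _ := GRing.Lalgebra_isAlgebra.Build K E endo_scalerAr.
End Endomorphisms.

(** * A representation of g by right translations *)

Section RightTranslation.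
Variables (K : fieldType) (g : lmodType K) (br : g -> g -> g).
Local Notation L := (seq g -> g).

Definition univ_hom_pred : pred L :=
  fun a => `[< multilinear a /\ forall k, lie_compatible br k a >].

Lemma univ_hom_pred_submod : submod_closed univ_hom_pred.
Proof.
have MS := multilinear_subspace g; have CS k := lie_compatible_subspace br k.
split=> [|c a b /asboolP[Ma Ca] /asboolP[Mb Cb]]; apply/asboolP; split=> [|k].
- exact: MS.1.
- exact: (CS k).1.
- exact: MS.2.
- by apply: (CS k).2.
Qed.

(* The functions on words that factor through the enveloping algebra. *)
Record univ_hom := UnivHom {
  univ_hom_fun :> L;
  univ_hom_funP : univ_hom_fun \in univ_hom_pred
}.
Local Notation W := univ_hom.

HB.instance Definition _ := [isSub for univ_hom_fun].
HB.instance Definition _ := [Choice of W by <:].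
HB.instance Definition _ :=
  GRing.SubChoice_isSubLmodule.Build K L univ_hom_pred W univ_hom_pred_submod.

Lemma univ_homP (a b : W) : a =1 b :> L -> a = b.
Proof. by move=> ab; apply/val_inj/funext. Qed.

Lemma univ_hom_multilinear (a : W) : multilinear a.
Proof. by have /asboolP[] := univ_hom_funP a. Qed.

Lemma univ_hom_lie_compatible (a : W) k : lie_compatible br k a.
Proof. by have /asboolP[] := univ_hom_funP a. Qed.

Lemma translate_subproof x (a : W) : (fun w => a (rcons w x)) \in univ_hom_pred.
Proof.
apply/asboolP; split=> [p q c y z|k p q y z _]; rewrite !rcons_cat !rcons_cons.
  exact: univ_hom_multilinear.
exact: (@univ_hom_lie_compatible a _ p (rcons q x) y z (leqnn _)).
Qed.

(** Letters are appended on the right so that composition of translations keeps the order of the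
    factors. Restricting to [W] is what makes these operators satisfy the bracket relation. *)
Definition translate x (a : W) : W := UnivHom (translate_subproof x a).

Lemma translate_linear x : translate x \in @linear_pred K W.
Proof. by apply/asboolP => c a b; apply: univ_homP. Qed.

Variable v : {v : W | v != 0}.

Definition translation x : endo v := Endo v (translate_linear x).

Lemma translation_lie_map : is_lie_map br translation.
Proof.
split=> [c x y|x y]; apply: endoP => a; apply: univ_homP => w.
  by rewrite -[RHS]/(c *: a (rcons w x) + a (rcons w y)) -!cats1 -univ_hom_multilinear cats1.
rewrite -[RHS]/(a (rcons (rcons w x) y) - a (rcons (rcons w y) x)).
rewrite -!cats1 -!catA /=.
by rewrite (@univ_hom_lie_compatible a _ w [::] x y (leqnn _)) cats1.
Qed.

Lemma translation_prod (xs : seq (nat * g)) (a : W) w :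
  (\prod_(p <- xs) translation p.2) a w = a (w ++ map snd xs).
Proof.
elim: xs w a => [|p xs IHxs] w a; first by rewrite big_nil cats0.
rewrite big_cons -[LHS]/((\prod_(q <- xs) translation q.2) a (rcons w p.2)).
by rewrite IHxs cat_rcons.
Qed.

End RightTranslation.

Section FilteredPBW.
Variables (K : fieldType) (g : lmodType K) (br : g -> g -> g) (F : nat -> g -> Prop).
Hypotheses (hK : [pchar K] =i pred0) (hbr : is_lie_bracket br) (hF : is_lie_filtration br F).
Variables (U : algType K) (iota : g -> U).
Hypothesis hU : is_enveloping br iota.

Lemma euler_letter x : euler_proj br [:: x] = x.
Proof. by rewrite -(euler_fix hbr) /= big_ord0 subr0. Qed.

Lemma euler_univ_hom : euler_proj br \in univ_hom_pred br.
Proof.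
apply/asboolP; split; first exact: multilinear_euler_proj.
by move=> k; apply: lie_compatible_euler_proj.
Qed.

(** The universal property turns translations into an action of [U]; evaluating it at [euler_proj]
    and the empty word extends the projection to [U]. It fixes x and maps monomials of weight at
    least n into [F n]. *)
Lemma FU_iota n x : (0 < n)%N -> FU F iota n (iota x) -> F n x.
Proof.
case: n => // n _ Fx; have FS := filtration_subspace hF n.
(* A nonzero x makes the projection nonzero, as [endo] requires. *)
have [->|x0] := eqVneq x 0; first by case: FS.
pose Pi : univ_hom br := UnivHom euler_univ_hom.
have Pi0 : Pi != 0.
  apply: contraNneq x0 => /(congr1 (fun a : univ_hom br => a [:: x])).
  by rewrite -[LHS]/(euler_proj br [:: x]) euler_letter => ->.
have [_ /(_ _ _ (translation_lie_map (exist _ Pi Pi0)))] := hU.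
move=> [phi [[phiL phi1 phiM] phi_iota _]].
have [ev [evL ev_monomial ev_iota]] : exists ev : U -> g,
    [/\ forall c u u', ev (c *: u + u') = c *: ev u + ev u',
        forall xs, ev (monomial iota xs) = euler_proj br (map snd xs) &
        ev (iota x) = x].
  exists (fun u => phi u Pi [::]); split=> [c u u'|xs|].
  - by rewrite phiL.
  - rewrite /monomial (big_morph phi phiM phi1).
    by under eq_bigr => p _ do rewrite phi_iota; rewrite translation_prod.
  - by rewrite phi_iota -[LHS]/(euler_proj br [:: x]) euler_letter.
have ev0 : ev 0 = 0 by have := evL (-1) 0 0; rewrite !scaleN1r oppr0 addr0 addNr.
case: Fx => // -[s [Fs xE]]; rewrite -ev_iota xE.
elim: s Fs {xE} => [|t s IHs] Fs; first by rewrite big_nil ev0; apply: FS.1.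
rewrite big_cons evL; apply: FS.2; last first.
  by apply: IHs => t' ts; apply: Fs; rewrite inE ts orbT.
have [_ wt nt] := Fs t (mem_head _ _).
rewrite ev_monomial; have := filtered_euler_proj hF wt.
by apply: (filtration_leq hF) => //; rewrite add0n (leq_trans nt) // leqSpred.
Qed.

End FilteredPBW.

(** * The filtration of the enveloping algebra *)

Section EnvelopingFiltration.
Variables (K : fieldType) (g : lmodType K) (br : g -> g -> g) (F : nat -> g -> Prop).
Hypotheses (hbr : is_lie_bracket br) (hF : is_lie_filtration br F).
Variables (U : algType K) (iota : g -> U).
Hypothesis hiota : is_lie_map br iota.

Lemma iotaB x y : iota (x - y) = iota x - iota y.
Proof. by rewrite addrC -scaleN1r hiota.1 scaleN1r addrC. Qed.

(** The condition is left free: [admissible] gives [FU], while [commutator_monomial] must also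
    control the length. *)
Definition monomial_span (P : seq (nat * g) -> Prop) (u : U) : Prop :=
  exists s : seq (K * seq (nat * g)),
    (forall t, t \in s -> P t.2) /\ u = \sum_(t <- s) t.1 *: monomial iota t.2.

Lemma monomial_span_subspace P : is_subspace (monomial_span P).
Proof.
split; first by exists [::]; rewrite big_nil.
move=> c u v [s [Ps ->]] [t [Pt ->]].
exists ([seq (c * r.1, r.2) | r <- s] ++ t); split.
  by move=> r; rewrite mem_cat => /orP[/mapP[q /Ps Pq ->]//|/Pt].
rewrite big_cat big_map scaler_sumr; congr (_ + _).
by apply: eq_bigr => r _; rewrite scalerA.
Qed.

Lemma mem_monomial_span (P : seq (nat * g) -> Prop) xs : P xs -> monomial_span P (monomial iota xs).
Proof.
move=> Pxs; exists [:: (1, xs)]; rewrite big_seq1 scale1r; split=> // t.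
by rewrite inE => /eqP->.
Qed.

Lemma monomial_span_ind (P : seq (nat * g) -> Prop) (C : U -> Prop) u : is_subspace C ->
  (forall xs, P xs -> C (monomial iota xs)) -> monomial_span P u -> C u.
Proof.
move=> CS CP [s [Ps ->]]; rewrite big_seq; apply: (big_ind C) => [|a b|t /Ps/CP Ct].
- exact: CS.1.
- exact: subspaceD.
- exact: subspaceZ.
Qed.

Lemma monomial_cons p xs : monomial iota (p :: xs) = iota p.2 * monomial iota xs.
Proof. exact: big_cons. Qed.

Lemma monomial_nseq n m x : monomial iota (nseq n (m, x)) = iota x ^+ n.
Proof. by elim: n => [|n IHn]; [exact: big_nil | rewrite monomial_cons IHn exprS]. Qed.

Lemma FU_subspace n : is_subspace (FU F iota n).
Proof.
case: n => [|n]; first by split=> *; left.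
have [S0 SL] := monomial_span_subspace (admissible F n.+1).
by split=> [|c u v [//|Su] [//|Sv]]; right => //; apply: SL.
Qed.

Lemma FU_leq m n u : (m <= n)%N -> FU F iota n u -> FU F iota m u.
Proof.
case: m => [|m] mn; first by left.
case=> [n0|[s [Ps ->]]]; first by rewrite n0 in mn.
right; exists s; split=> // t /Ps[s0 wt nt]; split=> //; exact: leq_trans nt.
Qed.

Lemma FU_monomial n xs : admissible F n xs -> FU F iota n (monomial iota xs).
Proof. by move=> Axs; right; apply: mem_monomial_span. Qed.

Lemma FU_iota_mem n x : (0 < n)%N -> F n x -> FU F iota n (iota x).
Proof.
move=> n0 Fx; have -> : iota x = monomial iota [:: (n, x)] by rewrite /monomial big_seq1.
apply: FU_monomial; split=> //; last by rewrite big_seq1.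
by move=> p; rewrite inE => /eqP->.
Qed.

Lemma FU_iota_mul m n x u : (0 < m)%N -> F m x -> (0 < n)%N ->
  FU F iota n u -> FU F iota (m + n) (iota x * u).
Proof.
move=> m0 Fx n0 [E|]; first by rewrite E in n0.
have [S0 SL] := FU_subspace (m + n).
apply: (monomial_span_ind (C := fun v => FU F iota (m + n) (iota x * v))).
  split=> [|c v w Fv Fw]; first by rewrite mulr0.
  by rewrite mulrDr -scalerAr; apply: SL.
move=> xs [_ wxs nxs]; rewrite -[x]/((m, x).2) -monomial_cons; apply: FU_monomial.
split=> //; last by rewrite big_cons leq_add2l.
by move=> p; rewrite inE => /predU1P[->//|/wxs].
Qed.

(** The commutator with y replaces one factor at a time by its bracket with y: the weight grows by q
    and the length is kept, which the induction in [FU_Rc_monomial] relies on. *)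
Lemma commutator_monomial q y xs : (0 < q)%N -> F q y -> weighted F xs ->
  monomial_span
    (fun ys => [/\ weighted F ys, size ys = size xs & (q + weight xs <= weight ys)%N])
    (iota y * monomial iota xs - monomial iota xs * iota y).
Proof.
move=> q0 Fy; elim: xs => [_|p xs IHxs wxs].
  by rewrite /monomial big_nil mulr1 mul1r subrr; apply: (monomial_span_subspace _).1.
have [p0 Fp] := wxs p (mem_head _ _).
have {}wxs : weighted F xs by move=> r rxs; apply: wxs; rewrite inE rxs orbT.
have -> : iota y * monomial iota (p :: xs) - monomial iota (p :: xs) * iota y =
    monomial iota ((q + p.1, br y p.2)%N :: xs)
    + iota p.2 * (iota y * monomial iota xs - monomial iota xs * iota y).
  by rewrite !monomial_cons /= hiota.2 mulrBl mulrBr !mulrA addrA subrK.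
set S := monomial_span _; have SS : is_subspace S by apply: monomial_span_subspace.
apply: (subspaceD SS).
  apply: mem_monomial_span; split=> //; last by rewrite /weight !big_cons addnA.
  move=> r; rewrite inE => /predU1P[->/=|/wxs//].
  by case: hF => _ _ _ Fbr; rewrite addn_gt0 q0; split=> //; apply: Fbr.
move: (IHxs wxs); apply: (monomial_span_ind (C := fun u => S (iota p.2 * u))).
  split=> [|c u v Su Sv]; first by rewrite mulr0; apply: SS.1.
  by rewrite mulrDr -scalerAr; apply: SS.2.
move=> ys [wys sys qys]; rewrite -monomial_cons; apply: mem_monomial_span; split.
- by move=> r; rewrite inE => /predU1P[->//|/wys].
- by rewrite /= sys.
- by rewrite /weight !big_cons addnCA leq_add2l.
Qed.

(** * The extended Rota-Baxter operator *)

Section RotaBaxter.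
Variables (R : g -> g) (Rc : U -> U).
Hypotheses (hRF : filtration_preserving F R) (hRc : is_Rcal R iota Rc).

Lemma RcB u v : Rc (u - v) = Rc u - Rc v.
Proof. by case: hRc => RcL _ _ _; rewrite addrC -scaleN1r RcL scaleN1r addrC. Qed.

Lemma Rc_sum_scale (I : Type) (r : seq I) (c : I -> K) (f : I -> U) :
  Rc (\sum_(i <- r) c i *: f i) = \sum_(i <- r) c i *: Rc (f i).
Proof.
elim: r => [|i r IHr]; first by rewrite !big_nil -[X in Rc X](subrr 0) RcB subrr.
by rewrite !big_cons -IHr; case: hRc => ->.
Qed.

Lemma Rc_starL y b : Rc (starL R iota y b) = iota (R y) * Rc b.
Proof.
case: hRc => RcL _ _ Rc_mul.
by rewrite /starL -[iota y * b]scale1r RcL scale1r Rc_mul subrK.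
Qed.

(** An exact equality of the truncations, not merely a congruence modulo the filtration. *)
Lemma Rc_exp_star y n : Rc (exp_star R iota y n) = expU (embed iota (Rhat R y)) n.
Proof.
rewrite /exp_star Rc_sum_scale; apply: eq_bigr => k _; congr (_ *: _).
elim: (k : nat) => [|j IHj]; first by case: hRc.
by rewrite /= Rc_starL IHj exprS.
Qed.

Lemma FU_Rc_monomial n xs : (0 < size xs)%N -> weighted F xs -> (n <= weight xs)%N ->
  FU F iota n (Rc (monomial iota xs)).
Proof.
case: hRc => RcL Rc1 Rc_iota Rc_mul.
move sxs: (size xs) => k; elim: k n xs sxs => [//|k IHk] n [//|p xs] [sxs] _ wxs.
have [p0 Fp] := wxs p (mem_head _ _).
have {}wxs : weighted F xs by move=> r rxs; apply: wxs; rewrite inE rxs orbT.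
rewrite /weight big_cons => nxs; apply: FU_leq nxs _.
(* A single letter is treated apart, since [FU_iota_mul] needs a tail of positive weight. *)
case: xs sxs wxs => [_ _|p' xs'].
  rewrite /monomial big_seq1 big_nil addn0 Rc_iota.
  by apply: FU_iota_mem => //; apply: hRF.
set xs := p' :: xs' => sxs wxs; have k0 : (0 < k)%N by rewrite -sxs.
have x0 : (0 < \sum_(r <- xs) r.1)%N.
  by have [p'0 _] := wxs p' (mem_head _ _); rewrite big_cons addn_gt0 p'0.
rewrite monomial_cons Rc_mul; have FS := FU_subspace (p.1 + \sum_(r <- xs) r.1).
apply: (subspaceB FS); first by apply: FU_iota_mul => //; [apply: hRF | apply: IHk].
have := commutator_monomial p0 (hRF p0 Fp) wxs.
apply: (monomial_span_ind (C := fun u => FU F iota _ (Rc u))).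
  split=> [|c u v Fu Fv]; last by rewrite RcL; apply: FS.2.
  by rewrite -(subrr 0) RcB subrr; apply: FS.1.
by move=> ys [wys sys qys]; apply: IHk => //; rewrite sys.
Qed.

Lemma FU_Rc n u : FU F iota n u -> FU F iota n (Rc u).
Proof.
case=> [->|]; first by left.
have FS := FU_subspace n; apply: (monomial_span_ind (C := fun u => FU F iota n (Rc u))).
  case: hRc => RcL _ _ _; split=> [|c v w Fv Fw]; last by rewrite RcL; apply: FS.2.
  by rewrite -(subrr 0) RcB subrr; apply: FS.1.
by move=> xs [xs0 wxs nxs]; apply: FU_Rc_monomial.
Qed.

End RotaBaxter.

(** Telescoping: the factor z - w has weight m and each of the k other factors has weight at least
    1. *)
Lemma FU_subX m z w k : (0 < m)%N -> F m (z - w) ->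
  FU F iota (m + k) (iota z ^+ k.+1 - iota w ^+ k.+1).
Proof.
move=> m0 Fzw; have F1 x : F 1 x by case: hF.
elim: k => [|k IHk]; first by rewrite !expr1 -iotaB addn0; apply: FU_iota_mem.
have -> : iota z ^+ k.+2 - iota w ^+ k.+2 =
    iota z * (iota z ^+ k.+1 - iota w ^+ k.+1)
    + monomial iota ((m, z - w) :: nseq k.+1 (1%N, w)).
  rewrite monomial_cons monomial_nseq /= iotaB mulrBr mulrBl addrA -!exprS.
  by rewrite subrK.
apply: (subspaceD (FU_subspace _)).
  by rewrite addnS -add1n; apply: FU_iota_mul => //; rewrite addn_gt0 m0.
apply: FU_monomial; split=> //.
  move=> p; rewrite inE => /predU1P[->//|/nseqP[-> _]]; by split.
by rewrite big_cons big_nseq iter_addn_0 mul1n.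
Qed.

End EnvelopingFiltration.

(** If z - w lies in [F m], the differences of powers above the first lie one step deeper, so the
    linear term does too, and [FU_iota] brings this back to g. *)
Lemma expU_inj (K : fieldType) (hK : [pchar K] =i pred0)
    (g : lmodType K) (br : g -> g -> g) (F : nat -> g -> Prop)
    (U : algType K) (iota : g -> U)
    (hbr : is_lie_bracket br) (hF : is_lie_filtration br F) (hU : is_enveloping br iota)
    (z w : nat -> g) :
  ghat_coherent F z -> ghat_coherent F w ->
  eqU F iota (expU (embed iota z)) (expU (embed iota w)) -> eqg F z w.
Proof.
move=> hz hw zw; have hiota := hU.1.
have diff m N : (m < N)%N -> F m.+1 (z N - w N).
  elim: m N => [|m IHm] N mN; first by case: hF.
  apply: (FU_iota hK hbr hF hU) => //.
  have FS := FU_subspace F iota m.+2.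
  have := FU_leq mN (zw N); rewrite /expU -sumrB.
  under eq_bigr => k _ do rewrite -scalerBr.
  have dN := IHm N (ltnW mN).
  case: N mN dN => [//|[//|N]] mN dN; rewrite 2!big_ord_recl !expr0 subrr scaler0 add0r.
  rewrite /bump /= invr1 scale1r -(iotaB hiota); set r := \sum_(k < N) _ => Fsum.
  rewrite -[iota _](addrK r).
  apply: (subspaceB FS Fsum).
  apply: (subspace_sum FS) => k _ _; apply: (subspaceZ _ FS).
  apply: (FU_leq (n := m.+1 + k.+1)); first by rewrite addnS ltnS leq_addr.
  exact: (FU_subX hF).
(* Component n of the exponentials is known only modulo F_n, whereas component n in the completion
   of g is taken modulo F_(n+1): use [diff] at n + 1 and return by coherence. *)
move=> n; have FS := filtration_subspace hF n.
have down u : ghat_coherent F u -> F n.+1 (u n.+1 - u n).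
  by move=> hu; apply: (filtration_leq hF) (hu n).
have -> : z n - w n = (z n.+1 - w n.+1) - ((z n.+1 - z n) - (w n.+1 - w n)).
  rewrite opprB (opprB (z n.+1)) addrA [X in _ = X + _]addrA subrK.
  by rewrite [RHS]addrC [RHS]addrA subrK.
apply: (subspaceB FS); first exact: diff.
by apply: (subspaceB FS); apply: down.
Qed.

Unset Implicit Arguments. Set Strict Implicit.

(* For x in \hat g:  frakR(x) := log(\hat{\mathcal R}(exp x)) is the unique
   z in \hat g with exp z = \hat{\mathcal R}(exp x), and Omega(x) := log_star(exp x)
   is the unique y in \hat g with exp_star y = exp x.  The claim frakR = \hat R o Omega
   then reads: z = \hat R y in \hat g. *)
Theorem theorem4p21 (K : fieldType) (hK : [pchar K] =i pred0)
  (g : lmodType K) (br : g -> g -> g) (F : nat -> g -> Prop) (R : g -> g)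
  (U : algType K) (iota : g -> U) (Rc : U -> U)
  (hbr : is_lie_bracket br) (hF : is_lie_filtration br F)
  (hR : is_RB_weight1 br R) (hRF : filtration_preserving F R)
  (hU : is_enveloping br iota) (hRc : is_Rcal R iota Rc)
  (x y z : nat -> g)
  (hx : ghat_coherent F x) (hy : ghat_coherent F y) (hz : ghat_coherent F z)
  (hOmega : eqU F iota (exp_star R iota y) (expU (embed iota x)))
  (hlog : eqU F iota (expU (embed iota z)) (Rcalhat Rc (expU (embed iota x)))) :
  eqg F z (Rhat R y).
Proof.
have [RL _] := hR; have hiota := hU.1.
have R_sub u v : R (u - v) = R u - R v by rewrite addrC -scaleN1r RL scaleN1r addrC.
apply: (expU_inj hK hbr hF hU) => // [n|n]; first by rewrite /Rhat -R_sub; apply: hRF.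
have FS := FU_subspace F iota n.
(* Insert Rc(exp x): one difference is [hlog], the other is [Rc] applied to [hOmega]. *)
rewrite -(Rc_exp_star hRc) -[expU _ n](subrK (Rcalhat Rc (expU (embed iota x)) n)) -addrA.
apply: (subspaceD FS) => //; rewrite -(RcB hRc) -opprB.
apply: (FU_Rc hF hiota hRF hRc); exact: (subspaceN FS (hOmega n)).
Qed.
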